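(* For all nonnegative multiplicity parameters $k:\Phi\to[0,\infty)$ and all $x\in V$, the map $s\mapsto G_{k,s}(x)$ is a log-convex function on $V$.
   Context: $V\cong\mathbb R^n$ is a Euclidean space with inner product $\langle\cdot,\cdot\rangle$, extended complex-bilinearly to the complexification $V_{\mathbb C}$. $\Phi\subset V$ is an irreducible crystallographic root system spanning $V$ (not necessarily reduced), $\Phi^+$ a choice of positive roots, $W_0$ the Weyl group generated by the reflections $s_\alpha x=x-2\frac{\langle\alpha,x\rangle}{\langle\alpha,\alpha\rangle}\alpha$. A multiplicity parameter is a $W_0$-invariant function $k$ on $\Phi$. Set $\rho=\frac12\sum_{\alpha\in\Phi^+}k(\alpha)\alpha$. For $\xi\in V$ and $f\in C^1(V)$ the Dunkl–Cherednik operator is $$D_{k,\xi}f(x)=\partial_\xi f(x)+\sum_{\alpha\in\Phi^+}k(\alpha)\frac{\langle\alpha,\xi\rangle}{1-e^{-\langle\alpha,x\rangle}}\big[f(x)-f(s_\alpha x)\big]-\langle\rho,\xi\rangle f(x).$$ For $s\in V_{\mathbb C}$, the Opdam–Cherednik kernel $G_{k,s}\in C^\infty(V)$ is the unique function with $D_{k,\xi}G_{k,s}=\langle s,\xi\rangle G_{k,s}$ for all $\xi\in V$ and $G_{k,s}(0)=1$. A function $f:X\to[0,\infty)$ on a convex set $X\subset V$ is log-convex if $f(tx+(1-t)y)\le f(x)^tf(y)^{1-t}$ for all $x,y\in X$, $t\in(0,1)$. *)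

(* Defs.v *)
From HB Require Import structures.
From mathcomp Require Import all_boot all_order all_algebra.
From mathcomp Require Import finmap.
From mathcomp Require Import all_classical all_reals all_analysis.
From mathcomp Require Import complex.

Set Implicit Arguments.
Unset Strict Implicit.
Unset Printing Implicit Defensive.

Import Order.TTheory GRing.Theory Num.Theory.
Import numFieldNormedType.Exports.

Local Open Scope ring_scope.
Local Open Scope complex_scope.

(* The Euclidean space V is 'rV[R]_n with the standard inner product, and its
   complexification is 'rV[R[i]]_n; taking K := R[i] below gives the
   complex-bilinear (not sesquilinear) extension. *)
Definition dot (K : comPzRingType) (n : nat) (u v : 'rV[K]_n) : K :=
  \sum_(i < n) u 0 i * v 0 i.

Definition complexify (R : realType) (n : nat) (u : 'rV[R]_n) : 'rV[R[i]]_n :=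
  map_mx (real_complex R) u.

Section RootSystems.
Context {R : realType} {n : nat}.
Notation V := 'rV[R]_n.

Definition coroot (a : V) : V := (2 / dot a a) *: a.

Definition refl (a x : V) : V := x - (2 * (dot a x / dot a a)) *: a.

Definition root_system (Phi : {fset V}) : Prop :=
  [/\ (<< enum_fset Phi >> = fullv)%VS,
      0 \notin Phi,
      forall a b : V, a \in Phi -> b \in Phi -> refl a b \in Phi &
      forall a b : V, a \in Phi -> b \in Phi ->
        2 * (dot a b / dot a a) \is a Num.int].

Definition irreducible_roots (Phi : {fset V}) : Prop :=
  Phi <> fset0 /\
  forall A B : {fset V}, Phi = (A `|` B)%fset ->
    (forall a b : V, a \in A -> b \in B -> dot a b = 0) ->
    A = fset0 \/ B = fset0.

Definition positive_roots (Phi Phip : {fset V}) : Prop :=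
  exists2 v : V, (forall a : V, a \in Phi -> dot a v != 0) &
    forall a : V, (a \in Phip) = (a \in Phi) && (0 < dot a v).

(* Since each reflection is an involution, closure under composition with
   reflections already gives closure under inverses. *)
Inductive weyl_group (Phi : {fset V}) : (V -> V) -> Prop :=
| weyl_id : weyl_group Phi id
| weyl_refl (a : V) (w : V -> V) :
    a \in Phi -> weyl_group Phi w -> weyl_group Phi (refl a \o w).

(* Only the values of k on Phi matter. *)
Definition multiplicity (Phi : {fset V}) (k : V -> R) : Prop :=
  forall w : V -> V, weyl_group Phi w ->
    forall a : V, a \in Phi -> k (w a) = k a.

Definition rho (Phip : {fset V}) (k : V -> R) : V :=
  2^-1 *: \sum_(a <- Phip) k a *: a.

Fixpoint Ck (m : nat) (f : V -> R) : Prop :=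
  if m is m'.+1 then
    [/\ continuous f, forall x v : V, derivable f x v &
        forall v : V, Ck m' (fun x => 'D_v f x)]
  else continuous f.

(* The qualified complex.Re, complex.Im land in R; the unqualified names are
   Num.Re, Num.Im, which land in R[i]. *)
Definition smooth (f : V -> R[i]) : Prop :=
  forall m : nat,
    Ck m (fun x => complex.Re (f x)) /\ Ck m (fun x => complex.Im (f x)).

Definition cderive (v : V) (f : V -> R[i]) (x : V) : R[i] :=
  ('D_v (fun y => complex.Re (f y)) x) +i* ('D_v (fun y => complex.Im (f y)) x).

(* [f(x) - f(s_a x)] / (1 - e^(-<a,x>)).  On the hyperplane <a,x> = 0 this
   reads 0/0 and stands for its continuous extension: for f of class C^1,
   f(x) - f(s_a x) = f(x) - f(x - <a,x> coroot a) is equivalent to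
   <a,x> times the derivative of f along coroot a, and 1 - e^(-<a,x>) to
   <a,x>. *)
Definition root_quotient (a : V) (f : V -> R[i]) (x : V) : R[i] :=
  if dot a x == 0 then cderive (coroot a) f x
  else (f x - f (refl a x)) / (1 - expR (- dot a x))%:C.

Definition dunkl_cherednik (Phip : {fset V}) (k : V -> R) (xi : V)
    (f : V -> R[i]) (x : V) : R[i] :=
  cderive xi f x
  + \sum_(a <- Phip) (k a * dot a xi)%:C * root_quotient a f x
  - (dot (rho Phip k) xi)%:C * f x.

Definition is_opdam_cherednik_kernel (Phip : {fset V}) (k : V -> R)
    (s : 'rV[R[i]]_n) (g : V -> R[i]) : Prop :=
  [/\ smooth g,
      forall xi x : V,
        dunkl_cherednik Phip k xi g x = dot s (complexify xi) * g x &
      g 0 = 1].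

Definition log_convex (f : V -> R) : Prop :=
  (forall x : V, 0 <= f x) /\
  forall (x y : V) (t : R), 0 < t < 1 ->
    f (t *: x + (1 - t) *: y) <= f x `^ t * f y `^ (1 - t).

End RootSystems.

(* Main.v *)
Require Import Defs.
From HB Require Import structures.
From mathcomp Require Import all_boot all_order all_algebra.
From mathcomp Require Import finmap.
From mathcomp Require Import all_classical all_reals all_analysis.
From mathcomp Require Import complex.
From mathcomp Require Import ring lra.

Set Implicit Arguments.
Unset Strict Implicit.
Unset Printing Implicit Defensive.

Import Order.TTheory GRing.Theory Num.Theory.
Import numFieldNormedType.Exports.

Local Open Scope ring_scope.
Local Open Scope complex_scope.

(** For real [s] let [F_s(r, y) = G_s(r y)], with [y] in a sphere, which the
    reflections preserve.  Along rays the eigenvalue equation reads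
    [dF/dr = <s + rho, y> F - sum_a c_a(r, y) (F(r, y) - F(r, s_a y))] with rates
    [c_a = k(a) <a, y> / (1 - e^(- r <a, y>)) >= 0] that do not depend on [s].  The
    off-diagonal part is thus nonnegative, and a maximum principle over the
    compact set [0, r0] x sphere holds.  It shows that [G_s] is real and positive;
    and by weighted AM-GM the geometric mean [F_{s1}^t F_{s2}^(1-t)] is a
    supersolution of the equation of [F_{t s1 + (1-t) s2}] with the same initial
    value, hence dominates it. *)

(** * Bilinear algebra of [dot] *)

Lemma dotDl (K : comPzRingType) (n : nat) (u v w : 'rV[K]_n) :
  dot (u + v) w = dot u w + dot v w.
Proof. by rewrite -big_split; apply: eq_bigr => i _; rewrite mxE mulrDl. Qed.

Lemma dotZl (K : comPzRingType) (n : nat) (c : K) (u v : 'rV[K]_n) :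
  dot (c *: u) v = c * dot u v.
Proof. by rewrite mulr_sumr; apply: eq_bigr => i _; rewrite mxE mulrA. Qed.

Lemma dotC (K : comPzRingType) (n : nat) (u v : 'rV[K]_n) : dot u v = dot v u.
Proof. by apply: eq_bigr => i _; rewrite mulrC. Qed.

Lemma dotDr (K : comPzRingType) (n : nat) (u v w : 'rV[K]_n) :
  dot u (v + w) = dot u v + dot u w.
Proof. by rewrite dotC dotDl !(dotC u). Qed.

Lemma dotZr (K : comPzRingType) (n : nat) (c : K) (u v : 'rV[K]_n) :
  dot u (c *: v) = c * dot u v.
Proof. by rewrite dotC dotZl dotC. Qed.

Lemma dot_complexify (R : realType) (n : nat) (u v : 'rV[R]_n) :
  dot (complexify u) (complexify v) = (dot u v)%:C.
Proof.
by rewrite rmorph_sum; apply: eq_bigr => i _; rewrite !mxE -rmorphM.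
Qed.

(** * Reflections, spheres and the maximum principle along rays *)

Section RayDynamics.
Context {R : realType} {n : nat}.
Implicit Types (a m y : 'rV[R]_n) (q r : R) (u : R -> 'rV[R]_n -> R).

Lemma reflZ a r y : refl a (r *: y) = r *: refl a y.
Proof.
rewrite /refl scalerBr scalerA; congr (_ - _ *: _).
by rewrite dotZr; ring.
Qed.

(* This also holds for [a = 0], where division by zero makes [refl a] the
   identity. *)
Lemma dot_refl a y : dot (refl a y) (refl a y) = dot y y.
Proof.
rewrite /refl -scaleNr; set c := - _.
rewrite dotDl !dotDr !dotZl !dotZr (dotC y a).
have [a0|a0] := eqVneq (dot a a) 0.
  by rewrite /c a0 invr0 !mulr0 oppr0 !mul0r !addr0.
by rewrite /c; field.
Qed.

Definition sphere q : set 'rV[R]_n := [set y | dot y y = q]%classic.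

(** The crude estimate [|w| <= 1 + w ^ 2] avoids square roots; only boundedness matters. *)
Lemma coord_le_sphere q y i : sphere q y -> `|y 0 i| <= 1 + q.
Proof.
move=> <-; rewrite /dot (bigD1 i)//=.
have : 0 <= \sum_(j < n | j != i) y 0 j * y 0 j.
  by apply: sumr_ge0 => j _; rewrite -expr2 sqr_ge0.
rewrite ler_norml; set z := \sum_(_ | _) _; set w := y 0 i => z0; nra.
Qed.

Lemma dot_le_sphere q m : exists2 K, 0 <= K &
  forall y, sphere q y -> `|dot m y| <= K.
Proof.
exists (\sum_i `|m 0 i| * (1 + `|q|)).
  by apply: sumr_ge0 => i _; rewrite mulr_ge0// addr_ge0.
move=> y yq; apply: le_trans (ler_norm_sum _ _ _) _.
apply: ler_sum => i _; rewrite normrM ler_wpM2l//.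
by apply: le_trans (coord_le_sphere i yq) _; rewrite lerD2l ler_norm.
Qed.

Lemma compact_sphere q : compact (sphere q).
Proof.
have box : compact [set v : 'rV[R]_n |
    forall i, v ord0 i \in `[(- (1 + q)), (1 + q)]].
  by apply: (@rV_compact _ _ (fun=> `[(- (1 + q)), (1 + q)]%classic)) => _;
    exact: segment_compact.
apply: subclosed_compact box _ => [|y yq i]; last first.
  by have := coord_le_sphere i yq; rewrite ler_norml in_itv.
apply: (@closed_comp _ _ (fun y => dot y y) [set q]) => [y _|]; last first.
  exact: closed_eq.
apply: continuous_big => [|i _ z]; first exact: add_continuous.
have zi := @coord_continuous R 1 n 0 i z; exact: (cvgM zi zi).
Qed.

(* Along the ray [r |-> r *: y] the eigenvalue equation of the kernel reads
   [d u r y / d r = ray_field u r y], the scalar [dot m y] collecting [s] and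
   [rho].  A root orthogonal to [y] contributes [0 / 0 = 0]. *)
Definition rate (k : 'rV[R]_n -> R) r y a :=
  k a * dot a y / (1 - expR (- (r * dot a y))).

Definition ray_field (Phip : {fset 'rV[R]_n}) (k : 'rV[R]_n -> R) m u r y :=
  dot m y * u r y - \sum_(a <- Phip) rate k r y a * (u r y - u r (refl a y)).

(** Fixing the sphere gives the compactness that the maximum principle needs; [r = 0], where the
    rates are singular, is excluded. *)
Definition ray_supersolution Phip k m q u := forall r y, 0 < r -> sphere q y ->
  exists2 d, is_derive r 1 (u^~ y) d & ray_field Phip k m u r y <= d.

(** For [r > 0], [dot a y] and [1 - expR (- (r * dot a y))] have the same sign. *)
Lemma rate_ge0 k r y a : 0 <= k a -> 0 < r -> 0 <= rate k r y a.
Proof.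
move=> ka r0; rewrite /rate -mulrA mulr_ge0//.
have [ay|ay] := leP 0 (dot a y).
  by rewrite divr_ge0// subr_ge0 expR_le1 oppr_le0 mulr_ge0// ltW.
rewrite -mulrNN -invrN mulr_ge0 ?oppr_ge0 ?(ltW ay)//.
by rewrite invr_ge0 opprB subr_ge0 -expR0 ler_expR oppr_ge0 nmulr_lle0 ?ltW.
Qed.

(** A minimum over [[0, r]] may sit at the right endpoint, so it has to be contradicted by a point
    on its left that stays in the interval. *)
Lemma is_derive_left_lt (f : R -> R) (x d : R) : is_derive x 1 f d -> 0 < d ->
  0 < x -> exists2 z, 0 <= z < x & f z < f x.
Proof.
move=> [df dfx] d0 x0.
have : ((fun h => h^-1 *: ((f \o shift x) (h *: 1) - f x)) @ 0^' --> d)%classic.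
  by rewrite -dfx.
move=> /cvg_dnbhs_at_left /cvgr_gt /(_ 0 d0) pos.
near (0 : R)^'-%classic => h.
have h0 : h < 0 by near: h; exact: nbhs_left_lt.
exists (h + x).
  apply/andP; split; last by rewrite gtrDr.
  rewrite -lerBlDr sub0r; near: h; apply: nbhs_left_ge.
  by rewrite oppr_lt0.
have : 0 < h^-1 *: ((f \o shift x) (h *: 1) - f x) by near: h; exact: pos.
by rewrite /= /GRing.scale/= mulr1 nmulr_rgt0 ?invr_lt0// subr_lt0.
Unshelve. all: by end_near. Qed.
(** Joint continuity yields a minimum over [[0, r]] x sphere. It is asked for [0 <= p.1] only, where
    powers of positive solutions are under control. *)
Definition ray_continuous u := forall p : R * 'rV[R]_n, 0 <= p.1 ->
  {for p, continuous (fun p => u p.1 p.2)}.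

(* At a negative minimum of [exp (- (K + 1) r) u] over [0, r0] x sphere, with
   [K] a bound for the scalar coefficient, every reflection term of the field
   has the good sign, so the radial derivative is positive there; this is
   impossible for [r > 0].  Only points with [r > 0] are tested, so the
   singularity of the rates at [r = 0] plays no role. *)
Lemma ray_supersolution_ge0 Phip k m q u :
  (forall a, a \in Phip -> 0 <= k a) ->
  ray_continuous u -> (forall y, 0 <= u 0 y) ->
  ray_supersolution Phip k m q u ->
  forall r y, 0 <= r -> sphere q y -> 0 <= u r y.
Proof.
move=> k0 uc u0 us r y r0 yq; rewrite leNgt; apply/negP => ury.
have [K K0 mK] := dot_le_sphere q m.
pose Z (p : R * 'rV[R]_n) := expR (- (K + 1) * p.1) * u p.1 p.2.
have Zc p : 0 <= p.1 -> {for p, continuous Z}.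
  move=> p0; have e : {for p, continuous (fun p => expR (- (K + 1) * p.1))}.
    apply: continuous_comp; last exact: continuous_expR.
    by apply: continuousM; [exact: cvg_cst|exact: cvg_fst].
  exact: (continuousM e (uc p p0)).
have [|||[s z]] := @compact_EVT_min _ _ Z (`[0, r]%classic `*` sphere q).
- by exists (r, y); split => //=; rewrite in_itv/= r0 lexx.
- by apply: compact_setX; [exact: segment_compact|exact: compact_sphere].
- apply: continuous_in_subspaceT => p; rewrite inE => -[/= + _].
  by rewrite in_itv/= => /andP[p0 _]; exact: Zc.
rewrite inE /= in_itv/= => -[/andP[s0 sr] zq] Zmin.
have {}Zmin s' z' : 0 <= s' <= r -> sphere q z' -> Z (s, z) <= Z (s', z').
  by move=> s'r z'q; apply: Zmin; rewrite inE /= in_itv.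
have : Z (s, z) < 0.
  apply: le_lt_trans (Zmin r y _ yq) _; first by rewrite r0 lexx.
  by rewrite /Z pmulr_rlt0 ?expR_gt0.
rewrite pmulr_rlt0 ?expR_gt0//= => usz.
have {}s0 : 0 < s.
  by rewrite lt_neqAle s0 andbT; apply: contraTneq usz => <-; rewrite -leNgt.
have umin a : u s z <= u s (refl a z).
  have := Zmin s (refl a z); rewrite /Z /= ler_pM2l ?expR_gt0//; apply.
    by rewrite (ltW s0).
  by rewrite /sphere /= dot_refl.
have [d ud fd] := us s z s0 zq.
(* As [u s z < 0] and [dot m z <= K], one has [dot m z * u s z >= K * u s z > (K + 1) * u s z]; the
   [+ 1] provides strictness. *)
have : 0 < expR (- (K + 1) * s) * (d - (K + 1) * u s z).
  rewrite mulr_gt0 ?expR_gt0// subr_gt0.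
  apply: lt_le_trans fd; rewrite ltrBrDr.
  have : \sum_(a <- Phip) rate k s z a * (u s z - u s (refl a z)) <= 0.
    rewrite big_seq; apply: sumr_le0 => a aP.
    by rewrite mulr_ge0_le0 ?subr_le0// rate_ge0// k0.
  have := mK z zq; rewrite ler_norml => /andP[_ mz].
  by move: (\sum_(a <- _) _) => S S0; nra.
have : is_derive s 1 (fun s => Z (s, z))
    (expR (- (K + 1) * s) * (d - (K + 1) * u s z)).
  have e : is_derive s 1 (fun s => expR (- (K + 1) * s))
      (expR (- (K + 1) * s) * (- (K + 1))).
    apply: (@is_derive1_comp _ expR).
    by apply: is_derive_eq; rewrite /GRing.scale/= mulr1.
  apply: is_derive_eq (is_deriveM e ud) _.
  by rewrite /GRing.scale/=; ring.
move=> /is_derive_left_lt h /h/(_ s0)[t /andP[t0 ts]].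
by rewrite ltNge Zmin// t0 (le_trans (ltW ts) sr).
Qed.

(** * Uniqueness and positivity of solutions *)

Definition ray_solution Phip k m u := forall r y, 0 < r ->
  is_derive r 1 (u^~ y) (ray_field Phip k m u r y).

Lemma ray_solution_super Phip k m q u :
  ray_solution Phip k m u -> ray_supersolution Phip k m q u.
Proof. by move=> su r y r0 _; exists (ray_field Phip k m u r y); [exact: su|]. Qed.

Lemma ray_fieldB Phip k m u v r y :
  ray_field Phip k m (fun r y => u r y - v r y) r y =
  ray_field Phip k m u r y - ray_field Phip k m v r y.
Proof.
rewrite /ray_field; set A := \sum_(a <- _) _; set B := \sum_(a <- _) _.
set C := \sum_(a <- _) _; have -> : A = B - C; last by ring.
by rewrite -sumrB; apply: eq_bigr => a _; ring.
Qed.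

Lemma ray_supersolutionB Phip k m q u v :
  ray_supersolution Phip k m q u -> ray_solution Phip k m v ->
  ray_supersolution Phip k m q (fun r y => u r y - v r y).
Proof.
move=> su sv r y r0 yq; have [d ud fd] := su r y r0 yq.
exists (d - ray_field Phip k m v r y); last by rewrite ray_fieldB lerD2r.
exact: is_deriveB ud (sv r y r0).
Qed.

Lemma ray_solution0 Phip k m : ray_solution Phip k m (fun _ _ => 0).
Proof.
move=> r y _; apply: is_derive_eq (is_derive_cst _ _ _) _.
rewrite /ray_field mulr0 sub0r big1 => [|a _]; first by rewrite oppr0.
by rewrite subrr mulr0.
Qed.

(** The maximum principle applies to both [u] and [0 - u] on the sphere through [y]. *)
Lemma ray_solution_eq0 Phip k m u :
  (forall a, a \in Phip -> 0 <= k a) ->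
  ray_continuous u -> (forall y, u 0 y = 0) ->
  ray_solution Phip k m u -> forall r y, 0 <= r -> u r y = 0.
Proof.
move=> k0 uc u0 su r y r0; apply/eqP; rewrite eq_le; apply/andP; split.
  rewrite -oppr_ge0 -sub0r.
  apply: (@ray_supersolution_ge0 Phip k m (dot y y) (fun r y => 0 - u r y)) => //.
  - by move=> p p0; apply: continuousB; [exact: cvg_cst|exact: uc].
  - by move=> z; rewrite u0 subr0 lexx.
  - by apply: ray_supersolutionB su; exact/ray_solution_super/ray_solution0.
apply: (@ray_supersolution_ge0 Phip k m (dot y y)) => //.
  by move=> z; rewrite u0.
exact: ray_solution_super.
Qed.

(* [exp (- K r)] is a subsolution, as the reflection terms vanish on functions
   of [r] alone. *)
Lemma ray_solution_gt0 Phip k m u :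
  (forall a, a \in Phip -> 0 <= k a) ->
  ray_continuous u -> (forall y, u 0 y = 1) ->
  ray_solution Phip k m u -> forall r y, 0 <= r -> 0 < u r y.
Proof.
move=> k0 uc u0 su r y r0; have [K K0 mK] := dot_le_sphere (dot y y) m.
apply: lt_le_trans (expR_gt0 (- K * r)) _; rewrite -subr_ge0.
pose v (r : R) (y : 'rV[R]_n) := u r y - expR (- K * r).
rewrite -/(v r y); apply: (@ray_supersolution_ge0 Phip k m (dot y y)) => //.
- move=> p p0; have e : {for p, continuous (fun p : R * 'rV[R]_n => expR (- K * p.1))}.
    apply: continuous_comp; last exact: continuous_expR.
    by apply: continuousM; [exact: cvg_cst|exact: cvg_fst].
  exact: (continuousB (uc p p0) e).
- by move=> z; rewrite /v u0 mulr0 expR0 subrr.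
- move=> s z s0 zq.
  have e : is_derive s 1 (fun s => expR (- K * s)) (expR (- K * s) * - K).
    apply: (@is_derive1_comp _ expR).
    by apply: is_derive_eq; rewrite /GRing.scale/= mulr1.
  exists (ray_field Phip k m u s z - expR (- K * s) * - K).
    exact: is_deriveB (su s z s0) e.
  rewrite ray_fieldB lerD2l lerN2 {1}/ray_field big1 => [|a _].
    rewrite subr0 [leLHS]mulrC ler_pM2r ?expR_gt0//.
    by have := mK z zq; rewrite ler_norml => /andP[].
  by rewrite subrr mulr0.
Qed.

(** * Geometric means of positive solutions *)

Lemma ray_continuous_powR u (c : R) :
  ray_continuous u -> (forall r y, 0 <= r -> 0 < u r y) ->
  ray_continuous (fun r y => u r y `^ c).
Proof.
move=> uc u_gt0 p p0.
have [dp _] := is_derive1_powR c (u_gt0 p.1 p.2 p0).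
have pc : {for u p.1 p.2, continuous (fun z : R => z `^ c)}.
  by apply: differentiable_continuous; exact/derivable1_diffP.
exact: (continuous_comp (uc p p0) pc).
Qed.

(** Young's inequality for [a ^ t] and [b ^ (1 - t)] with conjugate exponents [t^-1] and
    [(1 - t)^-1]. *)
Lemma powR_amgm (t a b : R) : 0 < t < 1 -> 0 < a -> 0 < b ->
  a `^ t * b `^ (1 - t) <= t * a + (1 - t) * b.
Proof.
move=> /andP[t0 t1] a0 b0; have t1' : 0 < 1 - t by rewrite subr_gt0.
have tV : 0 < t^-1 by rewrite invr_gt0.
have tV' : 0 < (1 - t)^-1 by rewrite invr_gt0.
have := conjugate_powR (powR_ge0 a t) (powR_ge0 b (1 - t)) tV tV'.
rewrite !invrK -!powRrM !mulfV ?gt_eqF// (powRr1 (ltW a0)) (powRr1 (ltW b0)).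
by rewrite (mulrC t) (mulrC (1 - t)); apply; rewrite subrKC.
Qed.

Lemma powR_ray_supersolution Phip k m0 m1 q t u0 u1 :
  (forall a, a \in Phip -> 0 <= k a) -> 0 < t < 1 ->
  (forall r y, 0 <= r -> 0 < u0 r y) -> (forall r y, 0 <= r -> 0 < u1 r y) ->
  ray_solution Phip k m0 u0 -> ray_solution Phip k m1 u1 ->
  ray_supersolution Phip k (t *: m0 + (1 - t) *: m1) q
    (fun r y => u0 r y `^ t * u1 r y `^ (1 - t)).
Proof.
move=> k0 t01 u0_gt0 u1_gt0 su0 su1 r y r0 _; have r0' := ltW r0.
have p0 := u0_gt0 r y r0'; have p1 := u1_gt0 r y r0'.
set h := fun r y => _ : R.
have hE : h r y = u0 r y `^ t * u1 r y `^ (1 - t) by [].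
have h_gt0 : 0 < h r y by rewrite mulr_gt0 ?powR_gt0.
set f0 := ray_field Phip k m0 u0 r y.
set f1 := ray_field Phip k m1 u1 r y.
(* The logarithmic derivative of [h] is the convex combination of those of [u0] and [u1]. *)
exists (h r y * (t * (f0 / u0 r y) + (1 - t) * (f1 / u1 r y))).
  have d0 : is_derive r 1 (fun r => u0 r y `^ t) (t * u0 r y `^ (t - 1) * f0).
    apply: (@is_derive1_comp R (fun z => z `^ t) (u0^~ y)); last exact: su0.
    exact: is_derive1_powR.
  have d1 : is_derive r 1 (fun r => u1 r y `^ (1 - t))
      ((1 - t) * u1 r y `^ (1 - t - 1) * f1).
    apply: (@is_derive1_comp R (fun z => z `^ (1 - t)) (u1^~ y)); last exact: su1.
    exact: is_derive1_powR.
  apply: is_derive_eq (is_deriveM d0 d1) _; rewrite /GRing.scale/= hE.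
  have pow1 (z w : R) : 0 < z -> z `^ (w - 1) = z `^ w / z.
    by move=> z0; rewrite powRB ?(powRr1 (ltW z0))// (gt_eqF z0) implybT.
  by rewrite !pow1//; field; rewrite !gt_eqF.
(* AM-GM is applied to the ratios of the values at [refl a y] and at [y]. *)
have amgm a : h r (refl a y) <= h r y *
    (t * (u0 r (refl a y) / u0 r y) + (1 - t) * (u1 r (refl a y) / u1 r y)).
  have q0 := u0_gt0 r (refl a y) r0'; have q1 := u1_gt0 r (refl a y) r0'.
  rewrite -ler_pdivrMl//.
  apply: le_trans (powR_amgm t01 (divr_gt0 q0 p0) (divr_gt0 q1 p1)).
  have powV (z w c : R) : 0 < z -> 0 < w -> (z / w) `^ c = z `^ c / w `^ c.
    move=> /ltW z0 /ltW w0; rewrite powRM ?invr_ge0//.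
    by rewrite -[w^-1](powR_inv1 w0) -powRrM mulN1r powRN.
  rewrite !powV// hE invfM mulrACA.
  by rewrite (mulrC (_ ^-1)) [X in _ * X]mulrC.
rewrite /f0 /f1 /ray_field dotDl !dotZl.
(* Since the rates are nonnegative, inserting the AM-GM bound can only increase the field; what then
   remains is an identity. *)
apply: (@le_trans _ _ ((t * dot m0 y + (1 - t) * dot m1 y) * h r y -
  \sum_(a <- Phip) rate k r y a * (h r y *
   (1 - (t * (u0 r (refl a y) / u0 r y) + (1 - t) * (u1 r (refl a y) / u1 r y)))))).
  rewrite lerD2l lerN2 !big_seq; apply: ler_sum => a aP.
  by rewrite ler_wpM2l ?rate_ge0 ?k0// mulrBr mulr1 lerB.
rewrite le_eqVlt; apply/orP; left; apply/eqP.
transitivity ((t * dot m0 y + (1 - t) * dot m1 y) * h r y - h r y * (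
   t / u0 r y * (\sum_(a <- Phip) rate k r y a * (u0 r y - u0 r (refl a y))) +
   (1 - t) / u1 r y * (\sum_(a <- Phip) rate k r y a * (u1 r y - u1 r (refl a y))))).
  congr (_ - _); rewrite !mulr_sumr -big_split mulr_sumr; apply: eq_bigr => a _ /=.
  by field; rewrite !gt_eqF.
by field; rewrite !gt_eqF.
Qed.

End RayDynamics.

(** * The kernel restricted to rays *)

Lemma is_derive_ray (R : realType) (n : nat) (f : 'rV[R]_n -> R) (r : R)
    (y : 'rV[R]_n) :
  derivable f (r *: y) y -> is_derive r 1 (fun r => f (r *: y)) ('D_y f (r *: y)).
Proof.
have E : (fun h : R => h^-1 *: (((fun r => f (r *: y)) \o shift r) (h *: 1) -
      f (r *: y))) =
    (fun h => h^-1 *: ((f \o shift (r *: y)) (h *: y) - f (r *: y))).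
  by apply/funext => h /=; rewrite scalerDl [h *: 1]mulr1.
by move=> df; split; rewrite /derivable/derive E.
Qed.

Section KernelAlongRays.
Context {R : realType} {n : nat}.
Variables (Phip : {fset 'rV[R]_n}) (k : 'rV[R]_n -> R) (s : 'rV[R]_n).
Variable g : 'rV[R]_n -> R[i].
Hypothesis hg : is_opdam_cherednik_kernel Phip k (complexify s) g.

(** This is the eigenvalue equation at [r *: y] with [xi = y]. A root orthogonal to [y] carries the
    factor [dot a y = 0], which removes the singular case of [root_quotient]. Writing the difference
    with [(-1)%:C] lets additive, real-homogeneous maps pass through it. *)
Lemma kernel_ray_equation (r : R) (y : 'rV[R]_n) : 0 < r ->
  cderive y g (r *: y) + \sum_(a <- Phip)
    (rate k r y a)%:C * (g (r *: y) + (-1)%:C * g (r *: refl a y)) =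
  (dot (s + rho Phip k) y)%:C * g (r *: y).
Proof.
move=> r0; have [_ /(_ y (r *: y)) eqg _] := hg.
have -> : (dot (s + rho Phip k) y)%:C =
    dot (complexify s) (complexify y) + (dot (rho Phip k) y)%:C.
  by rewrite dot_complexify dotDl rmorphD.
rewrite mulrDl -eqg /dunkl_cherednik subrK.
congr (_ + _); apply: eq_bigr => a _.
rewrite /root_quotient dotZr mulf_eq0 gt_eqF//= /rate.
have [->|ay0] := eqVneq (dot a y) 0; first by rewrite !(mulr0, mul0r).
have -> (c d : R) : (c / d)%:C = c%:C / d%:C by rewrite rmorphM fmorphV.
have -> : (-1)%:C = -1 :> R[i] by rewrite rmorphN1.
by rewrite mulN1r -reflZ mulrAC mulrA.
Qed.

(** All coefficients are real because [s] is, so the equation splits; [P] is to be the real or the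
    imaginary part. *)
Lemma ray_solution_part (P : R[i] -> R) :
  {morph P : x y / x + y} -> (forall c z, P (c%:C * z) = c * P z) ->
  (forall v x, P (cderive v g x) = 'D_v (fun z => P (g z)) x) ->
  (forall x v, derivable (fun z => P (g z)) x v) ->
  ray_solution Phip k (s + rho Phip k) (fun r y => P (g (r *: y))).
Proof.
move=> PD PZ PE dP r y r0; apply: is_derive_eq (is_derive_ray (dP _ _)) _.
rewrite -PE /ray_field -PZ -kernel_ray_equation// PD.
have P0 : P 0 = 0 by have := PZ 0 0; rewrite mulr0 mul0r.
rewrite (big_morph P PD P0) [X in _ = _ + X - _](eq_bigr (fun a =>
  rate k r y a * (P (g (r *: y)) - P (g (r *: refl a y))))) ?addrK// => a _.
by rewrite PZ PD PZ mulN1r.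
Qed.

Lemma Re_ray_solution :
  ray_solution Phip k (s + rho Phip k) (fun r y => complex.Re (g (r *: y))).
Proof.
apply: (@ray_solution_part (@complex.Re R)) => //.
- by move=> [? ?] [? ?].
- by move=> c [a b] /=; rewrite mul0r subr0.
- by have [/(_ 1)[[]]] := hg.
Qed.

Lemma Im_ray_solution :
  ray_solution Phip k (s + rho Phip k) (fun r y => complex.Im (g (r *: y))).
Proof.
apply: (@ray_solution_part (@complex.Im R)) => //.
- by move=> [? ?] [? ?].
- by move=> c [a b] /=; rewrite mul0r addr0.
- by have [/(_ 1)[_ []]] := hg.
Qed.

Lemma continuous_ray (f : 'rV[R]_n -> R) : continuous f ->
  ray_continuous (fun r y => f (r *: y)).
Proof. by move=> fc p _; apply: continuous_comp; [exact: scale_continuous|exact: fc]. Qed.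

Hypothesis k0 : forall a, a \in Phip -> 0 <= k a.

(** The imaginary part solves the linear ray equation with initial value [0]; uniqueness is used at
    [r = 1]. *)
Lemma kernel_Im0 x : complex.Im (g x) = 0.
Proof.
have [/(_ 0)[_ Ic] _ g0] := hg.
rewrite -[x]scale1r; apply: (ray_solution_eq0 k0 _ _ Im_ray_solution) => //.
  exact: (continuous_ray Ic).
by move=> y; rewrite scale0r g0.
Qed.

Lemma kernel_Re_gt0 (r : R) y : 0 <= r -> 0 < complex.Re (g (r *: y)).
Proof.
have [/(_ 0)[Rc _] _ g0] := hg.
apply: (ray_solution_gt0 k0 _ _ Re_ray_solution).
  exact: (continuous_ray Rc).
by move=> z; rewrite scale0r g0.
Qed.

End KernelAlongRays.

(** * Log-convexity by comparison on the sphere through [x] *)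

Theorem corollary4p6 (R : realType) (n : nat) (Phi Phip : {fset 'rV[R]_n})
    (hPhi : root_system Phi) (hirr : irreducible_roots Phi)
    (hpos : positive_roots Phi Phip)
    (k : 'rV[R]_n -> R) (hk : multiplicity Phi k)
    (hk0 : forall a : 'rV[R]_n, a \in Phi -> 0 <= k a)
    (G : 'rV[R[i]]_n -> 'rV[R]_n -> R[i])
    (hG : forall s : 'rV[R[i]]_n, is_opdam_cherednik_kernel Phip k s (G s))
    (x : 'rV[R]_n) :
  exists2 f : 'rV[R]_n -> R, log_convex f &
    forall s : 'rV[R]_n, G (complexify s) x = (f s)%:C.
Proof.
have k0 a : a \in Phip -> 0 <= k a.
  by have [v _ ->] := hpos => /andP[/hk0].
pose F s (r : R) (y : 'rV[R]_n) := complex.Re (G (complexify s) (r *: y)).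
have F_gt0 s r y : 0 <= r -> 0 < F s r y := kernel_Re_gt0 (hG _) k0 y.
exists (F^~ 1 ^~ x); last first.
  move=> s; have := kernel_Im0 (hG (complexify s)) k0 x.
  by rewrite /F scale1r; case: (G _ x) => a b /= ->.
split=> [s|s1 s2 t t01]; first exact/ltW/F_gt0.
have Fc s : ray_continuous (F s).
  by have [/(_ 0)[Rc _] _ _] := hG (complexify s); exact: (continuous_ray Rc).
have F0 s y : F s 0 y = 1.
  by have [_ _ g0] := hG (complexify s); rewrite /F scale0r g0.
have Fs s : ray_solution Phip k (s + rho Phip k) (F s) := Re_ray_solution (hG _).
have H_super := powR_ray_supersolution (q := dot x x) k0 t01 (F_gt0 s1) (F_gt0 s2)
  (Fs s1) (Fs s2).
have Fst := Fs (t *: s1 + (1 - t) *: s2).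
rewrite -subr_ge0; apply: (ray_supersolution_ge0 k0 _ _ (q := dot x x)
  (m := t *: s1 + (1 - t) *: s2 + rho Phip k)
  (u := fun r y => F s1 r y `^ t * F s2 r y `^ (1 - t) -
    F (t *: s1 + (1 - t) *: s2) r y)) => //.
- have Fpow s c := ray_continuous_powR (c := c) (Fc s) (F_gt0 s).
  move=> p p0; have Hc := continuousM (Fpow s1 t p p0) (Fpow s2 (1 - t) p p0).
  exact: (continuousB Hc (Fc _ p p0)).
- by move=> y; rewrite !F0 !powR1 mulr1 subrr.
- apply: ray_supersolutionB Fst.
  (* The shift by [rho] respects convex combinations because the weights sum to [1]. *)
  suff -> : t *: s1 + (1 - t) *: s2 + rho Phip k =
    t *: (s1 + rho Phip k) + (1 - t) *: (s2 + rho Phip k) by [].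
  by rewrite !scalerDr addrACA -scalerDl subrKC scale1r.
Qed.
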